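(* Let $D=D_1\times\dots\times D_n$ be a (not necessarily generic) product distribution over profiles of XOS valuations on the item set $[m]$, let $\alpha\in[0,1/2]$, and let $\mathbf{p}\in\mathbb{R}_{\ge0}^m$ be $\alpha$-median prices for $D$ witnessed by a choice rule profile $\mathbf{A}$. Then the expected social welfare of the sequential posted-price mechanism using prices $\mathbf{p}$ and choice rule $\mathbf{A}$ to resolve indifferences is at least $\alpha$ times the expected optimal social welfare, i.e. $$\mathbb{E}\Big[\sum_{i=1}^n v_i(A_i(\mathbf{v},\mathbf{p}))\Big]\ \ge\ \alpha\cdot\mathbb{E}\Big[\max_{(B_1,\dots,B_n)}\sum_{i=1}^n v_i(B_i)\Big],$$ where the expectations are over $\mathbf{v}\sim D$ and the randomness of $\mathbf{A}$, and the maximum is over all tuples of pairwise disjoint sets $B_1,\dots,B_n\subseteq[m]$.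
   Context: Valuations are functions $v:2^{[m]}\to\mathbb{R}_{\ge0}$ with $v(\emptyset)=0$ that are monotone ($v(S)\le v(T)$ for $S\subseteq T$). $v$ is XOS if there is a finite collection of additive functions $a_\ell(B)=\sum_{j\in B}a_\ell(j)$ with $a_\ell(j)\ge0$ such that $v(B)=\max_\ell a_\ell(B)$ for all $B\subseteq[m]$. Demand: for $\mathbf{p}\in\mathbb{R}_{\ge0}^m$ and $M\subseteq[m]$, the demand correspondence $\mathcal{D}(v,\mathbf{p},M)$ is the set of all $B\subseteq M$ maximizing $v(B)-\sum_{j\in B}p_j$ over subsets of $M$. Choice rule: a choice rule $A_i$ for agent $i$ maps each nonempty collection $\mathcal{D}\subseteq2^{[m]}$ to a probability distribution over elements of $\mathcal{D}$. For a choice rule profile $\mathbf{A}=(A_1,\dots,A_n)$, $\mathbf{v}$ and $\mathbf{p}$, the (random) allocation $(A_1(\mathbf{v},\mathbf{p}),\dots,A_n(\mathbf{v},\mathbf{p}))$ arises by letting agents $1,\dots,n$ arrive in this order, each agent $i$ receiving a set drawn (with fresh independent randomness) from $A_i(\mathcal{D}(v_i,\mathbf{p},M_i))$, where $M_i$ is the set of items not yet allocated. $\alpha$-median prices (general distributions): $\mathbf{p}$ are $\alpha$-median prices for $D$ witnessed by $\mathbf{A}$ if, for $\mathbf{v}\sim D$ and allocation according to $\mathbf{A}$ at prices $\mathbf{p}$, the probability that item $j$ is allocated lies in $[\alpha,1-\alpha]$ for every $j\in[m]$. *)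

(* Defs.v *)
From HB Require Import structures.
From mathcomp Require Import all_boot all_order all_algebra.
From mathcomp Require Import all_classical all_reals all_analysis.

Set Implicit Arguments.
Unset Strict Implicit.
Unset Printing Implicit Defensive.

Import Order.TTheory GRing.Theory Num.Theory.

Local Open Scope ring_scope.

Definition is_valuation (R : realType) (m : nat) (v : {set 'I_m} -> R) : Prop :=
  [/\ v finset.set0 = 0,
      (forall S, 0 <= v S) &
      (forall S T : {set 'I_m}, S \subset T -> v S <= v T)].

(* The index type 'I_k.+1 makes the collection nonempty; all the sums are
   nonnegative, so the default value 0 does not affect the maximum. *)
Definition is_xos (R : realType) (m : nat) (v : {set 'I_m} -> R) : Prop :=
  exists (k : nat) (a : 'I_k.+1 -> 'I_m -> R),
    (forall l j, 0 <= a l j) /\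
    (forall B : {set 'I_m}, v B = \big[Num.max/0]_(l < k.+1) \sum_(j in B) a l j).

Record xos_valuation (R : realType) (m : nat) := XosValuation {
  xos_fun :> {set 'I_m} -> R;
  xos_fun_valuation : is_valuation xos_fun;
  xos_fun_xos : is_xos xos_fun }.

Lemma is_valuation0 (R : realType) (m : nat) :
  is_valuation (fun _ : {set 'I_m} => 0 : R).
Proof. by []. Qed.

Lemma is_xos0 (R : realType) (m : nat) : is_xos (fun _ : {set 'I_m} => 0 : R).
Proof.
exists 0, (fun _ _ => 0); split=> // B.
by rewrite big_ord_recl big_ord0 big1// maxxx.
Qed.

HB.instance Definition _ (R : realType) (m : nat) :=
  gen_eqMixin (xos_valuation R m).
HB.instance Definition _ (R : realType) (m : nat) :=
  gen_choiceMixin (xos_valuation R m).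
HB.instance Definition _ (R : realType) (m : nat) :=
  isPointed.Build (xos_valuation R m)
    (XosValuation (is_valuation0 R m) (is_xos0 R m)).

(* The sigma-algebra on XOS valuations is the one inherited from the Borel
   sigma-algebra of R^(2^m), i.e. generated by the evaluations v |-> v S. *)
Definition evaluation_sets (R : realType) (m : nat) :
    set (set (xos_valuation R m)) :=
  [set C | exists (S : {set 'I_m}) (B : set R),
     measurable B /\ C = [set v : xos_valuation R m | B (v S)]]%classic.

Notation xos_space R m := (g_sigma_algebraType (@evaluation_sets R m)).

(* n.-tuple carries the product sigma-algebra.  The equation below
   characterizes the product measure D_1 x ... x D_n. *)
Definition is_product_distribution (R : realType) (n m : nat)
    (Di : 'I_n -> probability (xos_space R m) R)
    (D : probability (n.-tuple (xos_space R m)) R) : Prop :=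
  forall E : 'I_n -> set (xos_space R m),
    (forall i, measurable (E i)) ->
    D [set v : n.-tuple (xos_space R m) | forall i, E i (tnth v i)]%classic
      = (\prod_(i < n) Di i (E i))%E.

Definition demand (R : realType) (m : nat) (v : {set 'I_m} -> R)
    (p : 'I_m -> R) (M : {set 'I_m}) : {set {set 'I_m}} :=
  [set B in powerset M | [forall B' in powerset M,
     v B' - \sum_(j in B') p j <= v B - \sum_(j in B) p j]].

Record choice_rule (R : realType) (m : nat) := ChoiceRule {
  choice_prob :> {set {set 'I_m}} -> {set 'I_m} -> R;
  choice_prob_ge0 : forall C B, C != finset.set0 -> 0 <= choice_prob C B;
  choice_prob_out : forall C B,
    C != finset.set0 -> B \notin C -> choice_prob C B = 0;
  choice_prob_sum1 : forall C,
    C != finset.set0 -> \sum_(B in C) choice_prob C B = 1 }.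

Definition available (n m : nat) (B : {ffun 'I_n -> {set 'I_m}}) (i : 'I_n) :
    {set 'I_m} :=
  ~: \bigcup_(k < n | (k < i)%N) B k.

(* Probability, for a fixed valuation profile v, that the sequential process
   produces the allocation B.  By the chain rule, it is the product over i of
   the conditional probability that agent i draws B i given that the earlier
   agents k < i drew the sets B k.  Agents arrive in the order of 'I_n. *)
Definition allocation_prob (R : realType) (n m : nat)
    (A : 'I_n -> choice_rule R m) (p : 'I_m -> R)
    (v : n.-tuple (xos_space R m)) (B : {ffun 'I_n -> {set 'I_m}}) : R :=
  \prod_(i < n) A i (demand (tnth v i) p (available B i)) (B i).

Definition item_allocation_prob (R : realType) (n m : nat)
    (D : probability (n.-tuple (xos_space R m)) R)
    (A : 'I_n -> choice_rule R m) (p : 'I_m -> R) (j : 'I_m) : \bar R :=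
  (\int[D]_v (\sum_(B : {ffun 'I_n -> {set 'I_m}} | j \in \bigcup_i B i)
                allocation_prob A p v B)%:E)%E.

Definition median_prices (R : realType) (n m : nat)
    (D : probability (n.-tuple (xos_space R m)) R)
    (A : 'I_n -> choice_rule R m) (alpha : R) (p : 'I_m -> R) : Prop :=
  forall j : 'I_m,
    (alpha%:E <= item_allocation_prob D A p j <= (1 - alpha)%:E)%E.

Definition social_welfare (R : realType) (n m : nat)
    (v : n.-tuple (xos_space R m)) (B : {ffun 'I_n -> {set 'I_m}}) : R :=
  \sum_(i < n) (tnth v i : xos_valuation R m) (B i).

Definition expected_welfare (R : realType) (n m : nat)
    (D : probability (n.-tuple (xos_space R m)) R)
    (A : 'I_n -> choice_rule R m) (p : 'I_m -> R) : \bar R :=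
  (\int[D]_v (\sum_(B : {ffun 'I_n -> {set 'I_m}})
                allocation_prob A p v B * social_welfare v B)%:E)%E.

Definition pairwise_disjoint (n m : nat) (B : {ffun 'I_n -> {set 'I_m}}) : bool :=
  [forall i : 'I_n, forall k : 'I_n, (i != k) ==> [disjoint B i & B k]].

(* Welfare is nonnegative and the all-empty tuple is feasible, so the default
   value 0 does not affect the maximum. *)
Definition optimal_welfare (R : realType) (n m : nat)
    (v : n.-tuple (xos_space R m)) : R :=
  \big[Num.max/0]_(B : {ffun 'I_n -> {set 'I_m}} | pairwise_disjoint B)
     social_welfare v B.

Definition expected_optimal_welfare (R : realType) (n m : nat)
    (D : probability (n.-tuple (xos_space R m)) R) : \bar R :=
  (\int[D]_v (optimal_welfare v)%:E)%E.

(* Main.v *)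
(* Split the welfare of a posted-price outcome into revenue and utility.  The
   revenue is at least [alpha * \sum_j p j], since each item is sold with
   probability at least [alpha].  Agent [i] obtains the maximal utility over
   the set [M] of items still available, and [M] is independent of [v_i] and
   contains each item with probability at least [alpha].  Hence the utility of
   [x = v_i], averaged over [M] alone, is at least
   [alpha * (x S - \sum_(j in S) p j)] for every bundle [S]: buy the items of
   [S] that are available and worth their price in an additive function
   supporting [x] at [S].  As this holds pointwise in [x], the bundles of the
   optimal allocation can be used for [S] without any measurable selection;
   summing over the agents, the prices cancel against the revenue. *)
Require Import Defs.
From mathcomp Require Import all_boot all_order all_algebra.
From mathcomp Require Import all_classical all_reals all_analysis.
From mathcomp Require Import measurable_realfun lra.

Set Implicit Arguments.
Unset Strict Implicit.
Unset Printing Implicit Defensive.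

Import Order.TTheory GRing.Theory Num.Theory.
Import numFieldNormedType.Exports HBNNSimple.

Local Open Scope ring_scope.

(** * Integration against a product distribution on tuples *)

(** Linearity carries the identity from indicators to simple functions, and monotone convergence to
    all nonnegative [h]. With [phi] a coordinate and [G] the product of the other factors, it frees
    one coordinate of a product at a time. *)
Lemma integral_factor_extension (R : realType) (d d' : measure_display)
    (T : measurableType d) (X : measurableType d') (mu : {measure set T -> \bar R})
    (nu : {measure set X -> \bar R}) (G : T -> R) (phi : T -> X) (c : \bar R) :
  measurable_fun setT G -> (forall t, 0 <= G t) -> measurable_fun setT phi ->
  (0 <= c)%E ->
  (forall E, measurable E ->
     (\int[mu]_t (G t * \1_E (phi t))%:E = c * nu E)%E) ->
  forall h : X -> R, measurable_fun setT h -> (forall x, 0 <= h x) ->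
    (\int[mu]_t (G t * h (phi t))%:E = c * \int[nu]_x (h x)%:E)%E.
Proof.
move=> mG G0 mphi c0 HE h mh h0.
have mh' : measurable_fun setT (EFin \o h) by apply/measurable_EFinP.
have h0' x : setT x -> (0 <= (EFin \o h) x)%E by move=> _; rewrite lee_fin.
pose g := nnsfun_approx measurableT mh'.
have simple (f : {nnsfun X >-> R}) :
    (\int[mu]_t (G t * f (phi t))%:E = c * \int[nu]_x (f x)%:E)%E.
  have mE r : measurable (f @^-1` [set r]%classic) by exact: measurable_funPTI.
  under eq_integral.
    move=> t _; rewrite fimfunEord mulr_sumr -sumEFin.
    under eq_bigr do rewrite mulrCA.
    over.
  under [in RHS]eq_integral do rewrite fimfunEord -sumEFin.
  set s := finmap.enum_fset (fset_set (range f)).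
  have r0 (i : nat) : (0 <= s`_i)%R.
    have [si|si] := leqP (size s) i; first by rewrite nth_default.
    have : s`_i \in range f by rewrite -in_fset_set//; exact: mem_nth.
    by rewrite inE => -[x _ <-].
  have mf (i : nat) : measurable_fun setT (\1_(f @^-1` [set s`_i]%classic) : X -> R).
    exact: measurable_indic.
  rewrite !ge0_integral_sum//.
  - rewrite ge0_sume_distrr; last first.
      by move=> i _; apply: integral_ge0 => x _; rewrite lee_fin mulr_ge0.
    apply: eq_bigr => i _.
    under eq_integral do rewrite EFinM.
    under [in RHS]eq_integral do rewrite EFinM.
    rewrite !ge0_integralZl_EFin//.
    + by rewrite HE// integral_indic// setIT muleCA.
    + exact/measurable_EFinP.
    + by move=> x _; rewrite lee_fin mulr_ge0.
    + by apply/measurable_EFinP; apply: measurable_funM => //; exact: measurableT_comp.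
  - by move=> i; apply/measurable_EFinP; apply: measurable_funM.
  - by move=> i x _; rewrite lee_fin mulr_ge0.
  - move=> i; apply/measurable_EFinP; apply: measurable_funM => //.
    by apply: measurable_funM => //; exact: measurableT_comp.
  - by move=> i x _; rewrite lee_fin !mulr_ge0.
have gnd x : {homo (fun n => g n x) : n k / (n <= k)%N >-> n <= k}.
  by move=> n k nk; exact/lefP/nd_nnsfun_approx.
have cg x : ((g n x)%:E @[n --> \oo] --> (h x)%:E)%classic.
  exact: (cvg_nnsfun_approx measurableT mh').
have lhs : ((\int[mu]_t (G t * g n (phi t))%:E)%E @[n --> \oo] -->
            (\int[mu]_t (G t * h (phi t))%:E)%E)%classic.
  have -> : (\int[mu]_t (G t * h (phi t))%:E =
             \int[mu]_t limn (fun n => (G t * g n (phi t))%:E))%E.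
    apply: eq_integral => t _; apply/esym/cvg_lim => //.
    under eq_fun do rewrite EFinM.
    by rewrite EFinM; apply: cvgeZl.
  apply: cvg_monotone_convergence => //.
  - move=> n; apply/measurable_EFinP; apply: measurable_funM => //.
    exact: measurableT_comp.
  - by move=> n t _; rewrite lee_fin mulr_ge0.
  - by move=> t _ n k nk; rewrite lee_fin ler_wpM2l// gnd.
have rhs : ((\int[nu]_x (g n x)%:E)%E @[n --> \oo] -->
            (\int[nu]_x (h x)%:E)%E)%classic.
  have -> : (\int[nu]_x (h x)%:E = \int[nu]_x limn (fun n => (g n x)%:E))%E.
    by apply: eq_integral => t _; apply/esym/cvg_lim.
  apply: cvg_monotone_convergence => //.
  - by move=> n; exact/measurable_EFinP.
  - by move=> n t _; rewrite lee_fin.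
  - by move=> t _ n k nk; rewrite lee_fin gnd.
rewrite (funext (fun n => simple (g n))) in lhs.
apply: (cvg_unique _ lhs) => //.
(* Multiplication by [c = +oo] preserves convergence to a nonzero limit. If the limit is [0], the
   integrals of the [g n <= h] all vanish and the sequence is constantly [0]. *)
have [cfin|cinf] := boolP (c \is a fin_num); first exact: cvgeZl.
have [I0|I0] := eqVneq (\int[nu]_x (h x)%:E)%E 0%E; last first.
  by apply: (cvgeM _ (cvg_cst c) rhs); exact: mule_def_infty_neq0.
have g_int0 n : (\int[nu]_x (g n x)%:E)%E = 0%E.
  apply/eqP; rewrite eq_le; apply/andP; split; last first.
    by apply: integral_ge0 => x _; rewrite lee_fin.
  rewrite -I0; apply: ge0_le_integral => //.
  - by move=> x _; rewrite lee_fin.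
  - exact/measurable_EFinP.
  - move=> x _; rewrite lee_fin.
    have cgR : (g k x @[k --> \oo] --> h x)%classic by exact: fine_cvg (cg x).
    rewrite -(cvg_lim _ cgR)//; apply: nondecreasing_cvgn_le (gnd x) _ n.
    by apply/cvg_ex; exists (h x).
rewrite I0 (_ : (fun n => _) = cst 0%E) ?mule0; first exact: cvg_cst.
by apply/funext => n; rewrite g_int0 mule0.
Qed.

(** Induction on the number [l] of leading coordinates whose function is arbitrary, the others being
    indicators. For [l = 0] the product is the indicator of a box, whose measure is given; the step
    frees coordinate [l] by [integral_factor_extension]. *)
Lemma integral_prod_tnth (R : realType) (d : measure_display)
    (X : measurableType d) (n : nat) (Di : 'I_n -> probability X R)
    (D : probability (n.-tuple X) R) :
  (forall E : 'I_n -> set X, (forall i, measurable (E i)) ->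
    D [set v | forall i, E i (tnth v i)]%classic = \prod_(i < n) Di i (E i))%E ->
  forall h : 'I_n -> X -> R,
  (forall i, measurable_fun setT (h i)) -> (forall i x, 0 <= h i x) ->
  (\int[D]_v (\prod_(i < n) h i (tnth v i))%:E
     = \prod_(i < n) \int[Di i]_x (h i x)%:E)%E.
Proof.
move=> hD.
suff partial l : (l <= n)%N -> forall h : 'I_n -> X -> R,
    (forall i, measurable_fun setT (h i)) -> (forall i x, 0 <= h i x) ->
    (forall i : 'I_n, (l <= i)%N -> exists2 E, measurable E & h i = \1_E) ->
    (\int[D]_v (\prod_(i < n) h i (tnth v i))%:E
       = \prod_(i < n) \int[Di i]_x (h i x)%:E)%E.
  move=> h mh h0; apply: (partial n) => // i.
  by rewrite leqNgt ltn_ord.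
have mcoord (h : 'I_n -> X -> R) : (forall i, measurable_fun setT (h i)) ->
    forall i, measurable_fun setT (fun v : n.-tuple X => h i (tnth v i)).
  by move=> mh i; apply: measurableT_comp => //; exact: measurable_tnth.
elim: l => [_|l IH ln] h mh h0 hE.
  have hE' i : exists S, measurable S /\ h i = \1_S.
    by have [S mS hS] := hE i (leq0n _); exists S.
  have [E HE] := boolp.choice hE'.
  have prodE : (fun v : n.-tuple X => \prod_(i < n) h i (tnth v i)) =
      \1_[set v : n.-tuple X | forall i, E i (tnth v i)]%classic.
    apply/funext => v; rewrite indicE.
    have [vE|/existsNP[i vE]] := pselect (forall i, E i (tnth v i)).
      rewrite mem_set// big1// => i _.
      by rewrite (HE i).2 indicE mem_set.
    rewrite memNset; last by move=> /(_ i).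
    by rewrite (bigD1 i)//= (HE i).2 indicE memNset// mul0r.
  rewrite [X in integral _ _ X](_ : _ = EFin \o
    (fun v : n.-tuple X => \prod_(i < n) h i (tnth v i)))//.
  rewrite prodE integral_indic ?setIT//; last first.
    apply/(measurable_indicP R); rewrite -prodE.
    by apply: measurable_prod => i _; exact: mcoord.
  transitivity (\prod_(i < n) Di i (E i))%E.
    by apply: hD => i; exact: (HE i).1.
  apply: eq_bigr => i _; rewrite (HE i).2 integral_indic ?setIT//.
  exact: (HE i).1.
pose i := Ordinal ln.
under eq_integral do rewrite (bigD1 i)//= mulrC.
rewrite [RHS](bigD1 i)//= muleC.
apply: integral_factor_extension => //.
- under eq_fun do rewrite big_mkcond/=.
  by apply: measurable_prod => k _; case: (k != i) => //; exact: mcoord.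
- by move=> v; apply: prodr_ge0.
- exact: measurable_tnth.
- by apply: prode_ge0 => k _; apply: integral_ge0 => x _; rewrite lee_fin.
(* Putting an indicator at coordinate [i] leaves only the [l] leading functions arbitrary, so [IH]
   applies to [h']. *)
move=> E mE; pose h' k : X -> R := if k == i then \1_E else h k.
have h'k k : k != i -> h' k = h k by rewrite /h' => /negbTE ->.
have h'i : h' i = \1_E by rewrite /h' eqxx.
have mh' k : measurable_fun setT (h' k).
  by rewrite /h'; case: eqP => // _; exact: measurable_indic.
have h'0 k x : 0 <= h' k x by rewrite /h'; case: eqP.
clearbody h'.
transitivity (\int[D]_v (\prod_(k < n) h' k (tnth v k))%:E)%E.
  apply: eq_integral => v _; rewrite [in RHS](bigD1 i)//= h'i mulrC.
  by under [in RHS]eq_bigr do rewrite h'k//.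
rewrite IH//; last first.
- move=> k lk; have [->|ki] := eqVneq k i; first by exists E.
  by rewrite h'k//; apply: hE; rewrite ltn_neqAle lk andbT eq_sym.
- exact: ltnW.
rewrite (bigD1 i)//= h'i integral_indic// setIT muleC.
by under eq_bigr do rewrite h'k//.
Qed.

Lemma integral_probability_cst (R : realType) (d : measure_display)
    (X : measurableType d) (P : probability X R) (c : \bar R) :
  (\int[P]_x c = c)%E.
Proof.
rewrite (integral_cst P measurableT c) -[RHS]mule1; congr (_ * _)%E.
exact: probability_setT.
Qed.

Lemma integral_tnth (R : realType) (d : measure_display)
    (X : measurableType d) (n : nat) (Di : 'I_n -> probability X R)
    (D : probability (n.-tuple X) R) :
  (forall E : 'I_n -> set X, (forall i, measurable (E i)) ->
    D [set v | forall i, E i (tnth v i)]%classic = \prod_(i < n) Di i (E i))%E ->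
  forall (i : 'I_n) (g : X -> R),
  measurable_fun setT g -> (forall x, 0 <= g x) ->
  (\int[D]_v (g (tnth v i))%:E = \int[Di i]_x (g x)%:E)%E.
Proof.
move=> hD i g mg g0.
have := @integral_prod_tnth R d X n Di D hD (fun k => if k == i then g else cst 1).
rewrite [X in _ -> _ -> _ = X](bigD1 i)//= eqxx [X in (_ * X)%E]big1 ?mule1; last first.
  move=> k /negbTE ->. exact: (integral_probability_cst (Di k) 1%E).
move=> <-.
- apply: eq_integral => v _; rewrite (bigD1 i)//= eqxx big1 ?mulr1//.
  by move=> k /negbTE ->.
- by move=> k; case: eqP.
- by move=> k x; case: eqP.
Qed.

(** Independence: as [u i] is constant, the product does not depend on coordinate [i]. *)
Lemma integral_prod_tnth_mul (R : realType) (d : measure_display)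
    (X : measurableType d) (n : nat) (Di : 'I_n -> probability X R)
    (D : probability (n.-tuple X) R) :
  (forall E : 'I_n -> set X, (forall i, measurable (E i)) ->
    D [set v | forall i, E i (tnth v i)]%classic = \prod_(i < n) Di i (E i))%E ->
  forall (i : 'I_n) (u : 'I_n -> X -> R) (c : R) (g : X -> R),
  (forall k, measurable_fun setT (u k)) -> (forall k x, 0 <= u k x) ->
  (forall x, u i x = c) -> measurable_fun setT g -> (forall x, 0 <= g x) ->
  (\int[D]_v (\prod_(k < n) u k (tnth v k) * g (tnth v i))%:E =
   \int[D]_v (\prod_(k < n) u k (tnth v k))%:E * \int[D]_v (g (tnth v i))%:E)%E.
Proof.
move=> hD i u c g mu u0 uc mg g0.
have c0 : 0 <= c by rewrite -(uc point).
(* Absorbing [g] into coordinate [i] makes the left-hand integrand a product of one function per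
   coordinate. *)
pose u' k x := if k == i then c * g x else u k x.
transitivity (\int[D]_v (\prod_(k < n) u' k (tnth v k))%:E)%E.
  apply: eq_integral => v _; rewrite [in LHS](bigD1 i)//= [in RHS](bigD1 i)//=.
  rewrite {1}/u' eqxx uc mulrAC; congr (_ * _)%:E.
  by apply: eq_bigr => k /negbTE ki; rewrite /u' ki.
rewrite (integral_prod_tnth hD); last 2 first.
- by move=> k; rewrite /u'; case: eqP => // _; exact: measurable_funM.
- by move=> k x; rewrite /u'; case: eqP => // _; exact: mulr_ge0.
rewrite (integral_prod_tnth hD)// (integral_tnth hD)//.
rewrite [LHS](bigD1 i)//= [in RHS](bigD1 i)//=.
have -> : (\int[Di i]_x (u' i x)%:E = c%:E * \int[Di i]_x (g x)%:E)%E.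
  rewrite -ge0_integralZl_EFin//.
  - by apply: eq_integral => x _; rewrite /u' eqxx.
  - by move=> x _; rewrite lee_fin.
  - exact/measurable_EFinP.
have -> : (\int[Di i]_x (u i x)%:E = c%:E)%E.
  under eq_integral do rewrite uc.
  exact: integral_probability_cst.
rewrite muleAC; congr (_ * _ * _)%E.
by apply: eq_bigr => k /negbTE ki; rewrite /u' ki.
Qed.

(** * Sums over profiles of sequential draws *)

Definition upd (I : finType) (T : Type) (B : {ffun I -> T}) (l : I) (x : T) :
    {ffun I -> T} := [ffun k => if k == l then x else B k].

Lemma updE (I : finType) (T : Type) (B : {ffun I -> T}) (l : I) (x : T) :
  upd B l x l = x.
Proof. by rewrite ffunE eqxx. Qed.

Lemma upd_neq (I : finType) (T : Type) (B : {ffun I -> T}) (l k : I) (x : T) :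
  k != l -> upd B l x k = B k.
Proof. by rewrite ffunE => /negbTE ->. Qed.

Lemma upd_upd (I : finType) (T : Type) (B : {ffun I -> T}) (l : I) (x y : T) :
  upd (upd B l x) l y = upd B l y.
Proof. by apply/ffunP => k; rewrite !ffunE; case: eqP. Qed.

Lemma upd_id (I : finType) (T : Type) (B : {ffun I -> T}) (l : I) :
  upd B l (B l) = B.
Proof. by apply/ffunP => k; rewrite ffunE; case: eqP => // ->. Qed.

(** Exchanging the entry [B l] with [x] is an involution on the pairs [(B, x)]. *)
Lemma sum_upd (R : pzRingType) (I T : finType) (l : I) (g : {ffun I -> T} -> R) :
  \sum_B \sum_x g (upd B l x) = #|T|%:R * \sum_B g B.
Proof.
pose s (z : {ffun I -> T} * T) := (upd z.1 l z.2, z.1 l).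
have sK : involutive s by case=> B x; rewrite /s/= updE upd_upd upd_id.
rewrite pair_big/= (reindex_inj (inv_inj sK))/=.
under eq_bigr do rewrite upd_upd upd_id.
rewrite -(pair_big xpredT xpredT (fun B _ => g B))/= mulr_sumr.
by apply: eq_bigr => B _; rewrite sumr_const mulr_natl.
Qed.

(* The draws [k >= i] are replaced by uniform ones, rather than summed out, so
   that both sides range over full profiles. *)
Lemma sum_prod_marginal (R : numFieldType) (n : nat) (T : finType)
    (w : 'I_n -> {ffun 'I_n -> T} -> R) (F : {ffun 'I_n -> T} -> R) (i : nat) :
  (0 < #|T|)%N ->
  (forall (k l : 'I_n) B x, (k < l)%N -> w k (upd B l x) = w k B) ->
  (forall k B, \sum_x w k (upd B k x) = 1) ->
  (forall (l : 'I_n) B x, (i <= l)%N -> F (upd B l x) = F B) ->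
  \sum_B (\prod_k w k B) * F B =
  \sum_B (\prod_(k < n) (if (k < i)%N then w k B else #|T|%:R^-1)) * F B.
Proof.
move=> T0 wl w1 Fi.
have N0 : #|T|%:R != 0 :> R by rewrite pnatr_eq0 -lt0n.
pose S l := \sum_B (\prod_(k < n) (if (k < l)%N then w k B else #|T|%:R^-1)) * F B.
(* Average over entry [l]: the kernels before [l], the uniform factors after it and [F] ignore this
   entry, while kernel [l] sums to [1]. On the other side [#|T|] cancels the uniform factor of
   [l]. *)
have Sstep l : (i <= l)%N -> S l.+1 = S l.
  move=> il; have [nl|ln] := leqP n l.
    apply: eq_bigr => B _; congr (_ * _); apply: eq_bigr => k _.
    by rewrite !(leq_trans (ltn_ord k))// ltnW.
  pose l' := Ordinal ln.
  apply: (mulfI N0); rewrite -[LHS](sum_upd l') mulr_sumr.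
  apply: eq_bigr => B _.
  rewrite [in RHS](bigD1 l')//= ltnn -mulrA mulVKf//.
  rewrite -[RHS]mulr1 -[X in _ = _ * X](w1 l' B) mulr_sumr; apply: eq_bigr => x _.
  rewrite Fi// (bigD1 l')//= ltnSn [RHS]mulrC mulrA.
  congr (_ * _ * _).
  apply: eq_bigr => k kl; rewrite ltnS leq_eqVlt.
  have /negbTE -> /= : k != l :> nat by [].
  by case: ifP => // kl'; rewrite wl.
have Si k : S (i + k)%N = S i.
  by elim: k => [|k IH]; rewrite ?addn0// addnS Sstep// leq_addr.
(* All [k < n] satisfy [k < i + n], so [S (i + n)] is the full sum, whether or not [i <= n]. *)
rewrite -/(S i) -(Si n); apply: eq_bigr => B _; congr (_ * _).
by apply: eq_bigr => k _; rewrite ltn_addl.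
Qed.

(** With [i = 0] and [F = 1] every draw becomes uniform, and each of the [#|T| ^ n] profiles has
    weight [#|T| ^- n]. *)
Lemma sum_prod_kernel_eq1 (R : numFieldType) (n : nat) (T : finType)
    (w : 'I_n -> {ffun 'I_n -> T} -> R) :
  (0 < #|T|)%N ->
  (forall (k l : 'I_n) B x, (k < l)%N -> w k (upd B l x) = w k B) ->
  (forall k B, \sum_x w k (upd B k x) = 1) ->
  \sum_B \prod_k w k B = 1.
Proof.
move=> T0 wl w1; have N0 : #|T|%:R != 0 :> R by rewrite pnatr_eq0 -lt0n.
have := @sum_prod_marginal R n T w (fun=> 1) 0 T0 wl w1 (fun _ _ _ _ => erefl).
under eq_bigr do rewrite mulr1; move=> ->.
under eq_bigr do rewrite mulr1 prodr_const card_ord.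
by rewrite sumr_const card_ffun card_ord -[LHS]mulr_natr natrX -exprMn mulVf// expr1n.
Qed.

(** * The mechanism at a fixed valuation profile *)

Section mechanism.
Variables (R : realType) (n m : nat).
Implicit Types (v : n.-tuple (xos_space R m)) (B : {ffun 'I_n -> {set 'I_m}}).
Implicit Types (x : xos_valuation R m) (p : 'I_m -> R) (M S : {set 'I_m}).
Implicit Types (A : 'I_n -> choice_rule R m).

(** The indirect utility of [x] on [M]; the default [0] is the utility of the empty bundle. *)
Definition surplus p M x : R :=
  \big[Num.max/0]_(S : {set 'I_m} | S \subset M) (x S - \sum_(j in S) p j).

Lemma surplus_ge0 p M x : 0 <= surplus p M x.
Proof. exact: bigmax_ge_id. Qed.

Lemma le_surplus p M x S :
  S \subset M -> x S - \sum_(j in S) p j <= surplus p M x.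
Proof.
move=> SM.
exact: (le_bigmax_cond _ (fun S : {set 'I_m} => x S - \sum_(j in S) p j)).
Qed.

Lemma demand_neq0 p M x : demand x p M != finset.set0.
Proof.
apply/set0Pn.
have P0 : finset.set0 \in powerset M by rewrite powersetE finset.sub0set.
case: (arg_maxP (fun S => x S - \sum_(j in S) p j) P0) => S SM Smax.
exists S; rewrite finset.inE; apply/andP; split; first exact: SM.
by apply/forall_inP => S' S'M; exact: Smax.
Qed.

Lemma surplus_demand p M x S :
  S \in demand x p M -> surplus p M x <= x S - \sum_(j in S) p j.
Proof.
rewrite finset.inE => /andP[_ /forall_inP Smax]; apply: bigmax_le => [|S' S'M].
  have := Smax finset.set0; rewrite powersetE finset.sub0set => /(_ isT).
  by rewrite big_set0 subr0; have [-> _ _] := xos_fun_valuation x.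
by apply: Smax; rewrite powersetE.
Qed.

(* Keep, among the items of [S] still available, those whose weight in an
   additive function supporting [S] exceeds their price; the nonnegative gains
   [a j - p j] are then collected with probability at least [alpha]. *)
Lemma sum_surplus_ge p x (q : {set 'I_m} -> R) (alpha : R) S :
  0 <= alpha -> (forall M, 0 <= q M) ->
  (forall j, alpha <= \sum_(M : {set 'I_m} | j \in M) q M) ->
  alpha * (x S - \sum_(j in S) p j) <= \sum_M q M * surplus p M x.
Proof.
move=> alpha0 q0 qalpha; have [k [a [a0 xE]]] := xos_fun_xos x.
have [l xS] : exists l, x S = \sum_(j in S) a l j.
  have [|l _ xS] := eq_bigmax (x := 0) ord0 xpredT (fun l => \sum_(j in S) a l j) isT.
    by move=> l _; exact: sumr_ge0.
  by exists l; rewrite xE.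
pose gain j := Num.max 0 (a l j - p j).
have gain0 j : 0 <= gain j by rewrite le_max lexx.
have surplus_gain M : \sum_(j in S | j \in M) gain j <= surplus p M x.
  pose U := [set j in S | (j \in M) && (p j <= a l j)].
  apply: le_trans (_ : x U - \sum_(j in U) p j <= _); last first.
    by apply: le_surplus; apply/fintype.subsetP => j; rewrite finset.inE => /and3P[].
  (* At [U] the function [a l] need not support [x], but the maximum defining [x U] is at least its
     value. *)
  apply: le_trans (_ : \sum_(j in U) (a l j - p j) <= _); last first.
    rewrite sumrB lerD2r xE.
    exact: (le_bigmax_cond _ (fun l => \sum_(j in U) a l j)).
  rewrite (bigID (fun j => p j <= a l j))/= [X in _ + X]big1 ?addr0.
    rewrite le_eqVlt; apply/orP; left; apply/eqP; apply: eq_big => j.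
      by rewrite finset.inE andbA.
    by move=> /andP[_ pa]; rewrite /gain max_r// subr_ge0.
  by move=> j /andP[_]; rewrite -ltNge => pa; rewrite /gain max_l// subr_le0 ltW.
apply: le_trans (_ : \sum_M q M * (\sum_(j in S | j \in M) gain j) <= _); last first.
  by apply: ler_sum => M _; rewrite ler_wpM2l.
under [leRHS]eq_bigr do rewrite mulr_sumr.
(* After the exchange each [gain j] is weighted by the total [q]-mass of the sets containing [j],
   which is at least [alpha]. *)
rewrite (exchange_big_dep (mem S))/=; last by move=> ? ? _ /andP[].
rewrite xS -sumrB mulr_sumr; apply: ler_sum => j jS.
rewrite -mulr_suml.
apply: le_trans (_ : alpha * gain j <= _).
  by rewrite ler_wpM2l// le_max lexx orbT.
rewrite ler_wpM2r//; apply: le_trans (qalpha j) _.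
by under [leRHS]eq_bigl do rewrite jS.
Qed.

(** A kernel for [sum_prod_marginal]: it reads the entries of [B] only up to [k]. *)
Definition draw_prob A p v (k : 'I_n) B : R :=
  A k (demand (tnth v k) p (available B k)) (B k).

Lemma draw_prob_ge0 A p v k B : 0 <= draw_prob A p v k B.
Proof. by apply: choice_prob_ge0; exact: demand_neq0. Qed.

Lemma available_upd B (k l : 'I_n) S :
  (k <= l)%N -> available (upd B l S) k = available B k.
Proof.
move=> kl; congr (~: _); apply: eq_bigr => k' k'k.
by apply: upd_neq; rewrite -val_eqE/= neq_ltn (leq_trans k'k kl).
Qed.

Lemma draw_prob_upd A p v (k l : 'I_n) B S :
  (k < l)%N -> draw_prob A p v k (upd B l S) = draw_prob A p v k B.
Proof.
move=> kl; rewrite /draw_prob available_upd 1?ltnW// upd_neq//.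
by rewrite -val_eqE/= neq_ltn kl.
Qed.

Lemma sum_draw_prob A p v k B : \sum_S draw_prob A p v k (upd B k S) = 1.
Proof.
under eq_bigr do rewrite /draw_prob updE available_upd//.
set C := demand _ _ _.
rewrite -(choice_prob_sum1 (A k) (demand_neq0 p (available B k) (tnth v k))) -/C.
rewrite [RHS]big_mkcond/=; apply: eq_bigr => S _; case: ifPn => // SC.
by rewrite choice_prob_out// demand_neq0.
Qed.

Lemma allocation_probE A p v B :
  allocation_prob A p v B = \prod_k draw_prob A p v k B.
Proof. by []. Qed.

Lemma allocation_prob_ge0 A p v B : 0 <= allocation_prob A p v B.
Proof. by apply: prodr_ge0 => k _; exact: draw_prob_ge0. Qed.

Lemma card_set_gt0 : (0 < #|{set 'I_m}|)%N.
Proof. by apply/card_gt0P; exists finset.set0. Qed.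

Lemma sum_allocation_prob A p v : \sum_B allocation_prob A p v B = 1.
Proof.
apply: sum_prod_kernel_eq1; [exact: card_set_gt0| |exact: sum_draw_prob].
by move=> k l B S; exact: draw_prob_upd.
Qed.

(** On an outcome of positive probability every agent holds a demanded bundle, so her value is at
    least her surplus plus her payment; the payments cover the price of every sold item. *)
Lemma welfare_ge_surplus_revenue A p v : (forall j, 0 <= p j) ->
  \sum_i \sum_B allocation_prob A p v B * surplus p (available B i) (tnth v i)
  + \sum_j p j * \sum_(B : {ffun 'I_n -> {set 'I_m}} | j \in \bigcup_i B i)
                  allocation_prob A p v B
  <= \sum_B allocation_prob A p v B * social_welfare v B.
Proof.
move=> p0; rewrite exchange_big/=.
under [X in _ + X]eq_bigr do rewrite mulr_sumr big_mkcond/=.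
rewrite [X in _ + X]exchange_big -big_split/=; apply: ler_sum => B _.
(* Outcomes of probability [0], whose bundles need not be demanded, contribute [0] to both sides. *)
have [->|PB] := eqVneq (allocation_prob A p v B) 0.
  under eq_bigr do rewrite mul0r; rewrite big1// mul0r add0r big1// => j _.
  by rewrite mulr0 if_same.
have BD i : B i \in demand (tnth v i) p (available B i).
  have := PB; rewrite allocation_probE => /prodf_neq0 /(_ i isT).
  by apply: contraNT => BC; rewrite /draw_prob choice_prob_out// demand_neq0.
rewrite -mulr_sumr.
have -> : \sum_j (if j \in \bigcup_i B i then p j * allocation_prob A p v B else 0) =
    allocation_prob A p v B * \sum_(j in \bigcup_i B i) p j.
  by rewrite -big_mkcond/= mulr_sumr; apply: eq_bigr => j _; rewrite mulrC.
rewrite -mulrDr ler_wpM2l ?allocation_prob_ge0//.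
apply: le_trans (_ : \sum_i surplus p (available B i) (tnth v i) +
                     \sum_i \sum_(j in B i) p j <= _).
  rewrite lerD2l; under [leRHS]eq_bigr do rewrite big_mkcond/=.
  rewrite exchange_big/= big_mkcond/=; apply: ler_sum => j _.
  have Sp0 : 0 <= \sum_i (if j \in B i then p j else 0).
    by apply: sumr_ge0 => i _; case: ifP.
  case: ifP => // /bigcupP[i _ jBi].
  rewrite (bigD1 i)//= jBi lerDl.
  by apply: sumr_ge0 => k _; case: ifP.
rewrite -big_split/=; apply: ler_sum => i _.
by rewrite -lerBrDr surplus_demand.
Qed.
End mechanism.

(** * Measurability in the valuation profile *)

Lemma measurable_fun_forall (d : measure_display) (T : measurableType d)
    (I : finType) (f : I -> T -> bool) :
  (forall i, measurable_fun setT (f i)) ->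
  measurable_fun setT (fun x => [forall i, f i x]).
Proof.
move=> mf; have -> : (fun x => [forall i, f i x]) =
    (fun x => \big[andb/true]_i f i x).
  by apply/funext => x; rewrite big_andE; apply/forallP/forallP => H i; move: (H i).
have ms (s : seq I) : measurable_fun setT (fun x => \big[andb/true]_(i <- s) f i x).
  elim: s => [|i s IH].
    by under eq_fun do rewrite big_nil; exact: measurable_cst.
  by under eq_fun do rewrite big_cons; exact: measurable_and.
exact: ms.
Qed.

Lemma measurable_bigmaxr (d : measure_display) (T : measurableType d)
    (R : realType) (I : Type) (s : seq I) (P : pred I) (f : I -> T -> R) (r : R) :
  (forall i, measurable_fun setT (f i)) ->
  measurable_fun setT (fun x => \big[Num.max/r]_(i <- s | P i) f i x).
Proof.
move=> mf; elim: s => [|i s IH].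
  by under eq_fun do rewrite big_nil; exact: measurable_cst.
under eq_fun do rewrite big_cons.
by case: (P i) => //; exact: measurable_maxr.
Qed.

Section measurability.
Variables (R : realType) (n m : nat).
Implicit Types (p : 'I_m -> R) (M S : {set 'I_m}).
Implicit Types (B : {ffun 'I_n -> {set 'I_m}}).

Lemma measurable_evaluation S :
  measurable_fun setT (fun x : xos_space R m => (x : xos_valuation R m) S).
Proof.
by move=> _ B mB; rewrite setTI; apply: sub_sigma_algebra; exists S, B.
Qed.

Lemma measurable_utility p S : measurable_fun setT
  (fun x : xos_space R m => (x : xos_valuation R m) S - \sum_(j in S) p j).
Proof. by apply: measurable_funB => //; exact: measurable_evaluation. Qed.

Lemma measurable_surplus p M :
  measurable_fun setT (fun x : xos_space R m => surplus p M x).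
Proof. by apply: measurable_bigmaxr => S; exact: measurable_utility. Qed.

(** Fixing the membership of each [S] turns the event into a finite combination of comparisons
    between utilities, each measurable. *)
Lemma measurable_demand_eq p M (C : {set {set 'I_m}}) : measurable_fun setT
  (fun x : xos_space R m => demand (x : xos_valuation R m) p M == C).
Proof.
have -> : (fun x : xos_space R m => demand (x : xos_valuation R m) p M == C) =
    (fun x => [forall S, (S \in demand (x : xos_valuation R m) p M) == (S \in C)]).
  apply/funext => x; apply/eqP/forallP => [-> S|DC]; first exact: eqxx.
  by apply/setP => S; exact/eqP.
apply: measurable_fun_forall => S.
have mS : measurable_fun setT
    (fun x : xos_space R m => S \in demand (x : xos_valuation R m) p M).
  under eq_fun do rewrite finset.inE.
  apply: measurable_and => //; apply: measurable_fun_forall => S'.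
  case: (S' \in powerset M) => //=.
  by apply: measurable_fun_ler; exact: measurable_utility.
case: (S \in C); first by under eq_fun do rewrite eqb_id.
by under eq_fun do rewrite eqbF_neg; exact: measurable_neg.
Qed.

(** The rule is an arbitrary function of the demand set, but this set takes finitely many values,
    each on a measurable event. *)
Lemma measurable_choice_demand (A : choice_rule R m) p M S :
  measurable_fun setT
    (fun x : xos_space R m => A (demand (x : xos_valuation R m) p M) S).
Proof.
have -> : (fun x : xos_space R m => A (demand (x : xos_valuation R m) p M) S) =
    (fun x => \sum_C if demand (x : xos_valuation R m) p M == C then A C S else 0).
  by apply/funext => x; rewrite -big_mkcond/= (big_pred1 (demand x p M)).
apply: measurable_sum => C; apply: measurable_fun_ifT => //.
exact: measurable_demand_eq.
Qed.

Lemma measurable_allocation_prob (A : 'I_n -> choice_rule R m) p B :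
  measurable_fun setT
    (fun v : n.-tuple (xos_space R m) => allocation_prob A p v B).
Proof.
apply: measurable_prod => i _.
apply: (measurableT_comp (measurable_choice_demand _ _ _ _)).
exact: measurable_tnth.
Qed.

Lemma measurable_social_welfare B :
  measurable_fun setT (fun v : n.-tuple (xos_space R m) => social_welfare v B).
Proof.
apply: measurable_sum => i; apply: (measurableT_comp (measurable_evaluation _)).
exact: measurable_tnth.
Qed.

Lemma measurable_optimal_welfare :
  measurable_fun setT (fun v : n.-tuple (xos_space R m) => optimal_welfare v).
Proof. by apply: measurable_bigmaxr => B; exact: measurable_social_welfare. Qed.

End measurability.

(** * Expected surplus, availability and revenue *)

Section welfare.
Variables (R : realType) (n m : nat).
Implicit Types (v : n.-tuple (xos_space R m)) (B : {ffun 'I_n -> {set 'I_m}}).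
Implicit Types (p : 'I_m -> R) (M S : {set 'I_m}).
Implicit Types (A : 'I_n -> choice_rule R m).

Lemma sum_disjoint_le B p : pairwise_disjoint B -> (forall j, 0 <= p j) ->
  \sum_i \sum_(j in B i) p j <= \sum_j p j.
Proof.
move=> /forallP disjB p0.
rewrite -(partition_disjoint_bigcup _ (F := fun i => B i)); last first.
  by move=> i k ik; have /forallP/(_ k) := disjB i; rewrite ik.
by rewrite big_mkcond/=; apply: ler_sum => j _; case: ifP.
Qed.

(** The maximum is attained at a feasible [B]: the all-empty tuple is feasible and welfare is
    nonnegative, so the default [0] does no harm. *)
Lemma le_optimal_welfare v (c alpha : R) : 0 <= alpha ->
  (forall B, pairwise_disjoint B -> alpha * social_welfare v B <= c) ->
  alpha * optimal_welfare v <= c.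
Proof.
move=> alpha0 cB.
have disj0 : pairwise_disjoint [ffun _ : 'I_n => finset.set0 : {set 'I_m}].
  apply/forallP => i; apply/forallP => k; rewrite !ffunE.
  by rewrite finset.disjoints_subset finset.sub0set implybT.
rewrite /optimal_welfare; have [|B PB ->] :=
  eq_bigmax (x := 0) _ (@pairwise_disjoint n m) (social_welfare v) disj0.
  move=> B _; apply: sumr_ge0 => i _.
  by have [_ + _] := xos_fun_valuation (tnth v i); apply.
exact: cB.
Qed.

Definition available_prob A p v (i : 'I_n) M : R :=
  \sum_(B | available B i == M) allocation_prob A p v B.

Lemma available_prob_ge0 A p v i M : 0 <= available_prob A p v i M.
Proof. by apply: sumr_ge0 => B _; exact: allocation_prob_ge0. Qed.

Lemma measurable_available_prob A p i M :
  measurable_fun setT (fun v => available_prob A p v i M).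
Proof.
rewrite /available_prob; under eq_fun do rewrite big_mkcond/=.
apply: measurable_sum => B; case: (_ == M) => //.
exact: measurable_allocation_prob.
Qed.

Lemma available_prob_le1 A p v i M : available_prob A p v i M <= 1.
Proof.
rewrite -(sum_allocation_prob A p v) /available_prob big_mkcond/=.
by apply: ler_sum => B _; case: ifP => // _; exact: allocation_prob_ge0.
Qed.

(** The factors left by [sum_prod_marginal], each a function of one valuation, so that independence
    of the coordinates applies to their product. The factor at [k = i] is constant. *)
Definition prior_draw_prob A p (i : 'I_n) B (k : 'I_n) (x : xos_space R m) : R :=
  if (k < i)%N then A k (demand (x : xos_valuation R m) p (available B k)) (B k)
  else #|{set 'I_m}|%:R^-1.

Lemma prior_draw_prob_ge0 A p i B k x : 0 <= prior_draw_prob A p i B k x.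
Proof.
rewrite /prior_draw_prob; case: ifP => _; last by rewrite invr_ge0.
by apply: choice_prob_ge0; exact: demand_neq0.
Qed.

Lemma measurable_prior_draw_prob A p i B k :
  measurable_fun setT (prior_draw_prob A p i B k).
Proof.
rewrite /prior_draw_prob; case: (k < i)%N => //.
exact: measurable_choice_demand.
Qed.

(** Availability to [i] ignores the entries from [i] on, so [sum_prod_marginal] applies to its
    indicator and removes the valuations of [i] and of all later agents. *)
Lemma available_probE A p v i M : available_prob A p v i M =
  \sum_(B | available B i == M) \prod_k prior_draw_prob A p i B k (tnth v k).
Proof.
rewrite /available_prob [LHS]big_mkcond [RHS]big_mkcond/=.
have := @sum_prod_marginal R n {set 'I_m} (draw_prob A p v)
  (fun B => (available B i == M)%:R) i (card_set_gt0 m) => H.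
transitivity (\sum_B (\prod_k draw_prob A p v k B) * (available B i == M)%:R).
  by apply: eq_bigr => B _; case: (_ == M); rewrite ?mulr1 ?mulr0.
rewrite H.
- apply: eq_bigr => B _; case: (_ == M); rewrite ?mulr1 ?mulr0//.
- by move=> k l B S; exact: draw_prob_upd.
- exact: sum_draw_prob.
- by move=> l B S il; rewrite available_upd.
Qed.

Lemma sum_available_prob A p v i (F : {set 'I_m} -> R) :
  \sum_B allocation_prob A p v B * F (available B i) =
  \sum_M available_prob A p v i M * F M.
Proof.
rewrite (partition_big (fun B => available B i) xpredT)//=.
apply: eq_bigr => M _; rewrite /available_prob mulr_suml.
by apply: eq_bigr => B /eqP ->.
Qed.

(** An item that nobody receives is still available to [i]. Equality can fail, since an item
    available to [i] and sold from [i] on is counted twice. *)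
Lemma allocated_or_available A p v i j :
  1 <= \sum_(B : {ffun 'I_n -> {set 'I_m}} | j \in \bigcup_i B i)
         allocation_prob A p v B
       + \sum_(M : {set 'I_m} | j \in M) available_prob A p v i M.
Proof.
have -> : \sum_(M : {set 'I_m} | j \in M) available_prob A p v i M =
    \sum_B allocation_prob A p v B * (j \in available B i)%:R.
  rewrite (sum_available_prob A p v i (fun M => (j \in M)%:R)) big_mkcond/=.
  by apply: eq_bigr => M _; case: (j \in M); rewrite ?mulr1 ?mulr0.
rewrite -[leLHS](sum_allocation_prob A p v) [X in _ <= X + _]big_mkcond/= -big_split/=.
apply: ler_sum => B _; have P0 := allocation_prob_ge0 A p v B.
case: ifPn => [_|jB]; first by rewrite lerDl mulr_ge0.
rewrite add0r (_ : j \in available B i) ?mulr1//.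
rewrite finset.inE; apply: contra jB => /bigcupP[k _ jk].
by apply/bigcupP; exists k.
Qed.

Section product_distribution.
Variables (Di : 'I_n -> probability (xos_space R m) R).
Variables (D : probability (n.-tuple (xos_space R m)) R).
Hypothesis hD : is_product_distribution Di D.

(* The items available to agent [i] depend only on the agents before [i]. *)
Lemma integral_available_surplus A p i M :
  (\int[D]_v (available_prob A p v i M * surplus p M (tnth v i))%:E =
   \int[D]_v (available_prob A p v i M)%:E *
   \int[D]_v (surplus p M (tnth v i))%:E)%E.
Proof.
have ms := measurable_surplus p M.
have mu B : measurable_fun setT
    (fun v => \prod_k prior_draw_prob A p i B k (tnth v k)).
  apply: measurable_prod => k _.
  apply: (measurableT_comp (measurable_prior_draw_prob A p i B k)).
  exact: measurable_tnth.
have mst : measurable_fun setT (fun v => surplus p M (tnth v i)).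
  by apply: (measurableT_comp ms); exact: measurable_tnth.
have u0 B v : 0 <= \prod_k prior_draw_prob A p i B k (tnth v k).
  by apply: prodr_ge0 => k _; exact: prior_draw_prob_ge0.
have s0 v : 0 <= surplus p M (tnth v i) by exact: surplus_ge0.
(* The availability factors become finite sums over [B] of products with one factor per agent;
   [big_filter] moves the condition on [B] into the list, so that sum and integral commute. *)
under eq_integral.
  move=> v _; rewrite available_probE mulr_suml -sumEFin -big_filter.
  over.
under [X in (X * _)%E]eq_integral.
  move=> v _; rewrite available_probE -sumEFin -big_filter.
  over.
rewrite !ge0_integral_sum//.
- rewrite ge0_sume_distrl; last first.
    by move=> B _; apply: integral_ge0 => v _; rewrite lee_fin.
  apply: eq_bigr => B _.
  apply: (integral_prod_tnth_mul hD (c := #|{set 'I_m}|%:R^-1)) => //.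
  + exact: measurable_prior_draw_prob.
  + exact: prior_draw_prob_ge0.
  + by move=> x; rewrite /prior_draw_prob ltnn.
  + by move=> x; exact: surplus_ge0.
- by move=> B; exact/measurable_EFinP.
- by move=> B v _; rewrite lee_fin.
- by move=> B; apply/measurable_EFinP; exact: measurable_funM.
- by move=> B v _; rewrite lee_fin mulr_ge0.
Qed.

(** A real number rather than an extended one, as [sum_surplus_ge] takes real weights. *)
Definition mean_available A p i M : R :=
  fine (\int[D]_v (available_prob A p v i M)%:E).

Lemma mean_availableE A p i M :
  ((mean_available A p i M)%:E = \int[D]_v (available_prob A p v i M)%:E)%E.
Proof.
have mP := measurable_available_prob A p i M.
rewrite fineK// ge0_fin_numE; last first.
  by apply: integral_ge0 => v _; rewrite lee_fin available_prob_ge0.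
rewrite (@le_lt_trans _ _ (\int[D]_v 1)%E)//.
  apply: ge0_le_integral => //.
  - by move=> v _; rewrite lee_fin available_prob_ge0.
  - exact/measurable_EFinP.
  - by move=> v _; rewrite lee_fin available_prob_le1.
by rewrite (integral_probability_cst D 1%E) ltry.
Qed.

Lemma mean_available_ge0 A p i M : 0 <= mean_available A p i M.
Proof.
rewrite -lee_fin mean_availableE; apply: integral_ge0 => v _.
by rewrite lee_fin available_prob_ge0.
Qed.

Definition item_sold A p (j : 'I_m) v : R :=
  \sum_(B : {ffun 'I_n -> {set 'I_m}} | j \in \bigcup_i B i)
    allocation_prob A p v B.

Lemma item_sold_ge0 A p j v : 0 <= item_sold A p j v.
Proof. by apply: sumr_ge0 => B _; exact: allocation_prob_ge0. Qed.

Lemma measurable_item_sold A p j : measurable_fun setT (item_sold A p j).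
Proof.
rewrite /item_sold; under eq_fun do rewrite big_mkcond/=.
apply: measurable_sum => B; case: (j \in _) => //.
exact: measurable_allocation_prob.
Qed.

(** Expectation of [allocated_or_available]; the upper half of the median condition enters here. *)
Lemma le_sum_mean_available A p (alpha : R) i j :
  (item_allocation_prob D A p j <= (1 - alpha)%:E)%E ->
  alpha <= \sum_(M : {set 'I_m} | j \in M) mean_available A p i M.
Proof.
move=> sold; have mP M := measurable_available_prob A p i M.
have P0 M v := available_prob_ge0 A p v i M.
have msold := measurable_item_sold A p j.
set q := \sum_(M | _) _.
suff : (1%:E <= (1 - alpha)%:E + q%:E)%E by rewrite -EFinD lee_fin; lra.
apply: le_trans (leeD2r _ sold).
have -> : (q%:E = \int[D]_v
    (\sum_(M : {set 'I_m} | j \in M) available_prob A p v i M)%:E)%E.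
  rewrite /q -sumEFin -big_filter.
  under eq_bigr do rewrite mean_availableE.
  rewrite -ge0_integral_sum//.
  - by apply: eq_integral => v _; rewrite big_filter sumEFin.
  - by move=> M; exact/measurable_EFinP.
  - by move=> M v _; rewrite lee_fin.
have mA : measurable_fun setT
    (fun v => \sum_(M : {set 'I_m} | j \in M) available_prob A p v i M).
  under eq_fun do rewrite big_mkcond/=.
  by apply: measurable_sum => M; case: (j \in M).
rewrite -[leLHS](integral_probability_cst D) /item_allocation_prob -ge0_integralD//.
- apply: ge0_le_integral => //.
  + apply/measurable_EFinP; exact: measurable_funD.
  + by move=> v _; rewrite -EFinD lee_fin allocated_or_available.
- by move=> v _; rewrite lee_fin item_sold_ge0.
- exact/measurable_EFinP.
- by move=> v _; rewrite lee_fin sumr_ge0.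
- exact/measurable_EFinP.
Qed.

(** Expectation of [welfare_ge_surplus_revenue], in which independence replaces the availability law
    at [v] by its mean. The bound [alpha] on availability, which is known only on average, can then
    be used at every [v]. *)
Lemma expected_welfare_ge A p : (forall j, 0 <= p j) ->
  (\int[D]_v (\sum_i \sum_M mean_available A p i M * surplus p M (tnth v i))%:E
   + \sum_j (p j)%:E * item_allocation_prob D A p j
   <= expected_welfare D A p)%E.
Proof.
move=> p0.
have ms i M : measurable_fun setT (fun v => surplus p M (tnth v i)).
  apply: (measurableT_comp (measurable_surplus p M)); exact: measurable_tnth.
have s0 M v i : 0 <= surplus p M (tnth v i) by exact: surplus_ge0.
have q0 i M := mean_available_ge0 A p i M.
have P0 i M v := available_prob_ge0 A p v i M.
have mP i M := measurable_available_prob A p i M.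
have sold0 j v := item_sold_ge0 A p j v.
have msold j := measurable_item_sold A p j.
have utility :
    (\int[D]_v
       (\sum_i \sum_M mean_available A p i M * surplus p M (tnth v i))%:E =
     \int[D]_v
       (\sum_i \sum_M available_prob A p v i M * surplus p M (tnth v i))%:E)%E.
  under eq_integral do rewrite pair_big/= -sumEFin.
  under [RHS]eq_integral do rewrite pair_big/= -sumEFin.
  rewrite !ge0_integral_sum//.
  - apply: eq_bigr => -[i M] _ /=; rewrite integral_available_surplus -mean_availableE.
    under eq_integral do rewrite EFinM.
    rewrite ge0_integralZl_EFin//.
    + by move=> v _; rewrite lee_fin.
    + exact/measurable_EFinP.
  - by case=> i M; apply/measurable_EFinP; exact: measurable_funM.
  - by case=> i M v _; rewrite lee_fin mulr_ge0.
  - by case=> i M; apply/measurable_EFinP; exact: measurable_funM.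
  - by case=> i M v _; rewrite lee_fin mulr_ge0.
have revenue : (\sum_j (p j)%:E * item_allocation_prob D A p j =
    \int[D]_v (\sum_j p j * item_sold A p j v)%:E)%E.
  under [RHS]eq_integral do rewrite -sumEFin.
  rewrite ge0_integral_sum//.
  - apply: eq_bigr => j _; under [RHS]eq_integral do rewrite EFinM.
    rewrite ge0_integralZl_EFin//.
    + by move=> v _; rewrite lee_fin.
    + exact/measurable_EFinP.
  - by move=> j; apply/measurable_EFinP; exact: measurable_funM.
  - by move=> j v _; rewrite lee_fin mulr_ge0.
have mU : measurable_fun setT (fun v =>
    \sum_i \sum_M available_prob A p v i M * surplus p M (tnth v i)).
  by apply: measurable_sum => i; apply: measurable_sum => M; exact: measurable_funM.
have mV : measurable_fun setT (fun v => \sum_j p j * item_sold A p j v).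
  by apply: measurable_sum => j; exact: measurable_funM.
have U0 v : 0 <= \sum_i \sum_M available_prob A p v i M * surplus p M (tnth v i).
  by apply: sumr_ge0 => i _; apply: sumr_ge0 => M _; rewrite mulr_ge0.
have V0 v : 0 <= \sum_j p j * item_sold A p j v.
  by apply: sumr_ge0 => j _; rewrite mulr_ge0.
rewrite utility revenue -ge0_integralD//; last 4 first.
- by move=> v _; rewrite lee_fin.
- exact/measurable_EFinP.
- by move=> v _; rewrite lee_fin.
- exact/measurable_EFinP.
apply: ge0_le_integral => //.
- by move=> v _; rewrite -EFinD lee_fin addr_ge0.
- by apply/measurable_EFinP; exact: measurable_funD.
- apply/measurable_EFinP; apply: measurable_sum => B; apply: measurable_funM.
    exact: measurable_allocation_prob.
  exact: measurable_social_welfare.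
move=> v _; rewrite -EFinD lee_fin.
apply: le_trans (welfare_ge_surplus_revenue A v p0); rewrite lerD2r.
apply: ler_sum => i _.
by rewrite (sum_available_prob A p v i (fun M => surplus p M (tnth v i))).
Qed.

End product_distribution.
End welfare.

(** * Comparison with the optimal welfare *)

Theorem theorem4p12 (R : realType) (n m : nat)
    (Di : 'I_n -> probability (xos_space R m) R)
    (D : probability (n.-tuple (xos_space R m)) R)
    (hD : is_product_distribution Di D)
    (alpha : R) (halpha : (0 <= alpha <= 1 / 2%:R)%R)
    (A : 'I_n -> choice_rule R m)
    (p : 'I_m -> R) (hp : forall j, (0 <= p j)%R)
    (hmed : median_prices D A alpha p) :
  (alpha%:E * expected_optimal_welfare D <= expected_welfare D A p)%E.
Proof.
have /andP[alpha0 _] := halpha.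
apply: le_trans (expected_welfare_ge hD A hp).
pose q i M := mean_available D A p i M.
pose U (v : n.-tuple (xos_space R m)) : R :=
  \sum_i \sum_M q i M * surplus p M (tnth v i).
have q0 i M : 0 <= q i M by exact: mean_available_ge0.
have U0 v : 0 <= U v.
  by do 2!apply: sumr_ge0 => ? _; rewrite mulr_ge0// surplus_ge0.
have mU : measurable_fun setT U.
  apply: measurable_sum => i; apply: measurable_sum => M.
  apply: measurable_funM => //.
  by apply: (measurableT_comp (measurable_surplus p M)); exact: measurable_tnth.
have opt0 v : 0 <= optimal_welfare v :> R by exact: bigmax_ge_id.
have mopt := @measurable_optimal_welfare R n m.
have ap0 : 0 <= alpha * \sum_j p j by rewrite mulr_ge0// sumr_ge0.
(* The lower half of the median condition bounds the expected revenue from below by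
   [alpha * \sum_j p j]. *)
apply: le_trans (_ : (\int[D]_v (U v)%:E + (alpha * \sum_j p j)%:E <= _)%E); last first.
  apply: leeD2l; rewrite mulr_sumr -sumEFin; apply: lee_sum => j _.
  rewrite mulrC EFinM; apply: lee_wpmul2l; first by rewrite lee_fin.
  by have /andP[] := hmed j.
rewrite -ge0_integralZl_EFin//; last 2 first.
- by move=> v _; rewrite lee_fin.
- exact/measurable_EFinP.
(* The constant becomes an integral, so that the two sides can be compared at each [v]. *)
rewrite -[X in (_ <= _ + X)%E](integral_probability_cst D) -ge0_integralD//; last 2 first.
- by move=> v _; rewrite lee_fin.
- exact/measurable_EFinP.
apply: ge0_le_integral => //.
- by move=> v _; rewrite lee_fin mulr_ge0.
- by apply/measurable_EFinP; exact: measurable_funM.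
- by apply/measurable_EFinP; exact: measurable_funD.
move=> v _; rewrite -EFinD lee_fin; apply: le_optimal_welfare => // B disjB.
rewrite -lerBlDr -mulrBr.
(* Since the [B i] are disjoint, their prices sum to at most [\sum_j p j], the amount supplied by
   the revenue term. *)
apply: le_trans (_ : alpha * \sum_i ((tnth v i : xos_valuation R m) (B i) -
                                      \sum_(j in B i) p j) <= _).
  by rewrite ler_wpM2l// sumrB lerD2l lerN2 sum_disjoint_le.
rewrite mulr_sumr; apply: ler_sum => i _; apply: sum_surplus_ge => // j.
by apply: le_sum_mean_available; have /andP[] := hmed j.
Qed.
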